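(* Let $d\ge 2$. If two polynomial knots $\phi,\psi$ lie in the same path component of $\mathcal Q_d$, then $\phi$ and $\psi$ are topologically equivalent.
   Context: A polynomial knot is a map $\phi:\mathbb R\to\mathbb R^3$ with real polynomial components which is a smooth embedding ($\phi$ injective and $\phi'(t)\ne0$ for all $t$). For $d\ge2$, $\mathcal A_d$ is the set of polynomial maps $t\mapsto(f(t),g(t),h(t))$ with $\deg f\le d-2$, $\deg g\le d-1$, $\deg h\le d$, topologized via the bijection with $\mathbb R^{3d}$ sending $(f,g,h)$ to the vector $(a_0,\dots,a_{d-2},b_0,\dots,b_{d-1},c_0,\dots,c_d)$ of coefficients of $f=\sum a_it^i$, $g=\sum b_it^i$, $h=\sum c_it^i$. $\mathcal Q_d$ is the subspace of $\mathcal A_d$ consisting of polynomial knots $(f,g,h)$ with $\deg f=d-2$, $\deg g=d-1$, $\deg h=d$ exactly. A polynomial knot $\phi$ extends, via the inverse of stereographic projection $\mathbb R^3\to S^3\setminus\{N\}$ and sending $\infty\mapsto N$, to a unique continuous embedding (tame knot) $\tilde\phi:S^1\to S^3$. Two polynomial knots $\phi,\psi$ are topologically equivalent if $\tilde\phi$ and $\tilde\psi$ are ambient isotopic, i.e. there is a continuous $H:[0,1]\times S^3\to S^3$ with each $H(s,\cdot)$ a homeomorphism, $H(0,\cdot)=\mathrm{id}$ and $\tilde\psi=H(1,\cdot)\circ\tilde\phi$. *)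

(* Defs.v *)
From Stdlib Require Import Reals.
Open Scope R_scope.

Definition peval (n : nat) (c : nat -> R) (t : R) : R :=
  sum_f_R0 (fun i => c i * t ^ i) n.

(* The map t |-> (f t, g t, h t) of A_d, with deg f <= d-2, deg g <= d-1,
   deg h <= d; only coefficients a 0..a(d-2), b 0..b(d-1), c 0..c d matter. *)
Definition fA (d : nat) (a : nat -> R) : R -> R := peval (d - 2) a.
Definition gA (d : nat) (b : nat -> R) : R -> R := peval (d - 1) b.
Definition hA (d : nat) (c : nat -> R) : R -> R := peval d c.

Definition is_poly_knot (d : nat) (a b c : nat -> R) : Prop :=
  (forall t s : R,
      fA d a t = fA d a s -> gA d b t = gA d b s -> hA d c t = hA d c s -> t = s) /\
  (forall t l1 l2 l3 : R,
      derivable_pt_lim (fA d a) t l1 ->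
      derivable_pt_lim (gA d b) t l2 ->
      derivable_pt_lim (hA d c) t l3 ->
      ~ (l1 = 0 /\ l2 = 0 /\ l3 = 0)).

Definition in_Qd (d : nat) (a b c : nat -> R) : Prop :=
  is_poly_knot d a b c /\ a (d - 2)%nat <> 0 /\ b (d - 1)%nat <> 0 /\ c d <> 0.

Definition cont01 (f : R -> R) : Prop :=
  forall s, 0 <= s <= 1 -> forall eps, eps > 0 ->
    exists delta, delta > 0 /\
      forall s', 0 <= s' <= 1 -> Rabs (s' - s) < delta -> Rabs (f s' - f s) < eps.

(* phi = (a1,b1,c1) and psi = (a2,b2,c2) lie in the same path component of
   Q_d (viewed in R^{3d} via the relevant coefficients): there is a path
   [0,1] -> Q_d, continuous in each relevant coefficient (= continuous into
   R^{3d}), from phi to psi. *)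
Definition same_path_component_Qd (d : nat) (a1 b1 c1 a2 b2 c2 : nat -> R) : Prop :=
  exists A B C : R -> nat -> R,
    (forall i, (i <= d - 2)%nat -> cont01 (fun s => A s i)) /\
    (forall i, (i <= d - 1)%nat -> cont01 (fun s => B s i)) /\
    (forall i, (i <= d)%nat -> cont01 (fun s => C s i)) /\
    (forall s, 0 <= s <= 1 -> in_Qd d (A s) (B s) (C s)) /\
    (forall i, (i <= d - 2)%nat -> A 0 i = a1 i /\ A 1 i = a2 i) /\
    (forall i, (i <= d - 1)%nat -> B 0 i = b1 i /\ B 1 i = b2 i) /\
    (forall i, (i <= d)%nat -> C 0 i = c1 i /\ C 1 i = c2 i).

Definition R4 : Type := (R * R * R * R)%type.

Definition dist4 (p q : R4) : R :=
  let '(x1, x2, x3, x4) := p in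
  let '(y1, y2, y3, y4) := q in
  sqrt ((x1 - y1) ^ 2 + (x2 - y2) ^ 2 + (x3 - y3) ^ 2 + (x4 - y4) ^ 2).

Definition S3 (p : R4) : Prop :=
  let '(x1, x2, x3, x4) := p in x1 ^ 2 + x2 ^ 2 + x3 ^ 2 + x4 ^ 2 = 1.

Definition S1 (p : R * R) : Prop := let '(u, v) := p in u ^ 2 + v ^ 2 = 1.

Definition N3 : R4 := (0, 0, 0, 1).

Definition inv_stereo3 (x y z : R) : R4 :=
  let r := x ^ 2 + y ^ 2 + z ^ 2 in
  (2 * x / (r + 1), 2 * y / (r + 1), 2 * z / (r + 1), (r - 1) / (r + 1)).

(* The extension tilde(phi) : S^1 -> S^3 of a polynomial knot: S^1 \ {(0,1)}
   is identified with R by the inverse stereographic projection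
   t |-> (2t/(t^2+1), (t^2-1)/(t^2+1)) (whose inverse is (u,v) |-> u/(1-v)),
   and the point at infinity (0,1) is sent to the north pole N. *)
Definition ext_knot (d : nat) (a b c : nat -> R) (p : R * R) : R4 :=
  let '(u, v) := p in
  match Req_EM_T v 1 with
  | left _ => N3
  | right _ =>
      let t := u / (1 - v) in inv_stereo3 (fA d a t) (gA d b t) (hA d c t)
  end.

Definition cont_S3 (K : R4 -> R4) : Prop :=
  forall x, S3 x -> forall eps, eps > 0 ->
    exists delta, delta > 0 /\
      forall y, S3 y -> dist4 y x < delta -> dist4 (K y) (K x) < eps.

Definition ambient_isotopic (F G : R * R -> R4) : Prop :=
  exists H : R -> R4 -> R4,
    (forall s x, 0 <= s <= 1 -> S3 x -> S3 (H s x)) /\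
    (forall s x, 0 <= s <= 1 -> S3 x -> forall eps, eps > 0 ->
       exists delta, delta > 0 /\
         forall s' y, 0 <= s' <= 1 -> S3 y -> Rabs (s' - s) < delta ->
           dist4 y x < delta -> dist4 (H s' y) (H s x) < eps) /\
    (forall s, 0 <= s <= 1 ->
       cont_S3 (H s) /\
       exists K : R4 -> R4,
         (forall x, S3 x -> S3 (K x)) /\
         (forall x, S3 x -> K (H s x) = x) /\
         (forall x, S3 x -> H s (K x) = x) /\
         cont_S3 K) /\
    (forall x, S3 x -> H 0 x = x) /\
    (forall p, S1 p -> G p = H 1 (F p)).

Definition top_equivalent (d : nat) (a1 b1 c1 a2 b2 c2 : nat -> R) : Prop :=
  ambient_isotopic (ext_knot d a1 b1 c1) (ext_knot d a2 b2 c2).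

(* Main.v *)
Require Import Defs.
From Stdlib Require Import Reals Lra Lia Psatz IndefiniteDescription.
From Coquelicot Require Import Coquelicot.
Open Scope R_scope.

(** For a knot [phi] in Q_d, all the differences t^i - s^i with i <= d are
    O(|phi t - phi s|): divided by t - s this follows from the embedding
    property on compact squares, and at infinity from the leading terms, one of
    the degrees d - 1, d being odd.  Hence for [psi] close to [phi] the
    displacement psi - phi is a Lipschitz function of the point phi t with a
    small constant, and McShane's formula extends it to a 1/2-Lipschitz field V
    on R^3.  The maps x + s V x are bi-Lipschitz homeomorphisms of R^3
    carrying [phi] to [psi] at s = 1, and their extensions to S^3 are Lipschitz
    for the chordal metric, so no integration of vector fields is needed.  The
    role of [phi] and [psi] can be exchanged, isotopies compose pointwise, and
    connectedness of [0,1] finishes the proof. *)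

(** * Divided differences of polynomial curves *)

(* [divdiff i t s] is the polynomial (t^i - s^i) / (t - s). *)
Fixpoint divdiff (i : nat) (t s : R) : R :=
  match i with
  | O => 0
  | S j => t * divdiff j t s + s ^ j
  end.

Definition pdivdiff (n : nat) (c : nat -> R) (t s : R) : R :=
  sum_f_R0 (fun i => c i * divdiff i t s) n.

Lemma divdiff_spec i t s : t ^ i - s ^ i = (t - s) * divdiff i t s.
Proof.
induction i as [|i IH]; simpl; [ring|].
replace (t * t ^ i - s * s ^ i) with (t * (t ^ i - s ^ i) + (t - s) * s ^ i) by ring.
rewrite IH; ring.
Qed.

Lemma pdivdiff_spec n c t s : peval n c t - peval n c s = (t - s) * pdivdiff n c t s.
Proof.
unfold peval, pdivdiff; rewrite scal_sum, <- minus_sum.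
apply sum_eq; intros i _.
rewrite <- Rmult_minus_distr_l, divdiff_spec; ring.
Qed.

Lemma divdiff_cont i t s : continuity_2d_pt (divdiff i) t s.
Proof.
induction i as [|i IH]; simpl.
- apply continuity_2d_pt_const.
- apply (continuity_2d_pt_plus (fun t s => t * divdiff i t s) (fun _ s => s ^ i)).
  + now apply (continuity_2d_pt_mult (fun t _ => t)); [apply continuity_2d_pt_id1|].
  + clear IH; induction i as [|i IH]; simpl; [apply continuity_2d_pt_const|].
    now apply (continuity_2d_pt_mult (fun _ s => s)); [apply continuity_2d_pt_id2|].
Qed.

Lemma pdivdiff_cont n c t s : continuity_2d_pt (pdivdiff n c) t s.
Proof.
unfold pdivdiff; induction n as [|n IH]; simpl.
- apply (continuity_2d_pt_mult (fun _ _ => c O)); [apply continuity_2d_pt_const|].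
  apply (divdiff_cont 0).
- apply (continuity_2d_pt_plus _ (fun t s => c (S n) * divdiff (S n) t s)); [exact IH|].
  apply (continuity_2d_pt_mult (fun _ _ => c (S n))); [apply continuity_2d_pt_const|].
  apply (divdiff_cont (S n)).
Qed.

Lemma derivable_pt_lim_peval n c t :
  derivable_pt_lim (peval n c) t (pdivdiff n c t t).
Proof.
intros eps Heps.
destruct (pdivdiff_cont n c t t (mkposreal eps Heps)) as [del Hdel].
exists del; intros h Hh Hdh.
replace ((peval n c (t + h) - peval n c t) / h) with (pdivdiff n c (t + h) t)
  by (rewrite pdivdiff_spec; field; exact Hh).
apply Hdel.
- now replace (t + h - t) with h by ring.
- replace (t - t) with 0 by ring; rewrite Rabs_R0; apply cond_pos.
Qed.

(** * Growth of divided differences *)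

(** The factor [r] on the left turns the natural exponent [i - 1] into [i], which avoids truncated
    subtraction and covers [i = 0]. *)
Lemma divdiff_bound i t s r :
  Rabs t <= r -> Rabs s <= r -> Rabs (divdiff i t s) * r <= INR i * r ^ i.
Proof.
intros Ht Hs.
assert (Hr : 0 <= r) by (pose proof (Rabs_pos t); lra).
induction i as [|i IH].
- simpl; rewrite Rabs_R0; lra.
- rewrite S_INR; simpl divdiff; simpl pow.
  apply Rle_trans with ((Rabs t * Rabs (divdiff i t s) + Rabs s ^ i) * r).
  + apply Rmult_le_compat_r; [exact Hr|].
    rewrite <- Rabs_mult, RPow_abs; apply Rabs_triang.
  + assert (Rabs s ^ i <= r ^ i)
      by (apply pow_incr; split; [apply Rabs_pos|exact Hs]).
    assert (Rabs t * (Rabs (divdiff i t s) * r) <= r * (INR i * r ^ i)).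
    { apply Rmult_le_compat; try apply Rabs_pos; try assumption.
      apply Rmult_le_pos; [apply Rabs_pos|exact Hr]. }
    nra.
Qed.

Lemma divdiff_nonneg i t s : 0 <= t -> 0 <= s -> 0 <= divdiff i t s.
Proof.
intros Ht Hs; induction i as [|i IH]; simpl; [lra|].
pose proof (pow_le s i Hs); nra.
Qed.

(** Comes from t^2 - s^2 = (t - s)(t + s); the induction never divides by t - s, so the diagonal is
    included. *)
Lemma divdiff_double k t s :
  divdiff (2 * k) t s = (t + s) * divdiff k (t ^ 2) (s ^ 2).
Proof.
induction k as [|k IH]; [simpl; ring|].
replace (2 * S k)%nat with (S (S (2 * k))) by lia.
cbn [divdiff]; rewrite IH, <- pow_mult; simpl; ring.
Qed.

(** Symmetrizing the recursion in t and s leaves a sum of nonnegative terms. For even degrees the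
    quotient has the factor t + s and changes sign. *)
Lemma divdiff_odd k t s :
  2 * divdiff (S (2 * k)) t s =
  t ^ (2 * k) + s ^ (2 * k) + (t + s) ^ 2 * divdiff k (t ^ 2) (s ^ 2).
Proof.
pose proof (divdiff_spec (2 * k) t s) as E.
cbn [divdiff].
replace ((t + s) ^ 2 * divdiff k (t ^ 2) (s ^ 2))
  with ((t + s) * divdiff (2 * k) t s) by (rewrite divdiff_double; ring).
lra.
Qed.

Lemma divdiff_odd_lower k t s :
  Rmax (Rabs t) (Rabs s) ^ (2 * k) <= 2 * divdiff (S (2 * k)) t s.
Proof.
rewrite divdiff_odd.
pose proof (pow2_ge_0 (t + s)).
pose proof (divdiff_nonneg k (t ^ 2) (s ^ 2) (pow2_ge_0 t) (pow2_ge_0 s)).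
assert (Habs : forall x, Rabs x ^ (2 * k) = x ^ (2 * k))
  by (intros x; rewrite !pow_mult, pow2_abs; reflexivity).
assert (Hpos : forall x, 0 <= x ^ (2 * k))
  by (intros x; rewrite pow_mult; apply pow_le, pow2_ge_0).
pose proof (Hpos t); pose proof (Hpos s).
assert (0 <= (t + s) ^ 2 * divdiff k (t ^ 2) (s ^ 2)) by (now apply Rmult_le_pos).
unfold Rmax; destruct (Rle_dec (Rabs t) (Rabs s)); rewrite Habs; lra.
Qed.

Lemma sum_Rabs_le n (u v : nat -> R) :
  (forall i, (i <= n)%nat -> Rabs (u i) <= v i) -> Rabs (sum_f_R0 u n) <= sum_f_R0 v n.
Proof.
intros H; apply Rle_trans with (1 := Rsum_abs u n), sum_Rle; exact H.
Qed.

Lemma pdivdiff_bound n c : exists K, 0 <= K /\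
  forall t s r, 1 <= r -> Rabs t <= r -> Rabs s <= r ->
    Rabs (pdivdiff n c t s) * r <= K * r ^ n.
Proof.
exists (sum_f_R0 (fun i => Rabs (c i) * INR i) n); split.
- apply cond_pos_sum; intros i; apply Rmult_le_pos; [apply Rabs_pos|apply pos_INR].
- intros t s r Hr Ht Hs.
  unfold pdivdiff.
  rewrite <- (Rabs_pos_eq r) at 1 by lra.
  rewrite <- Rabs_mult, Rmult_comm, (Rmult_comm _ (r ^ n)), !scal_sum.
  apply sum_Rabs_le; intros i Hi.
  rewrite !Rabs_mult, (Rabs_pos_eq r) by lra.
  pose proof (divdiff_bound i t s r Ht Hs).
  pose proof (Rle_pow r i n Hr Hi).
  pose proof (pos_INR i); pose proof (Rabs_pos (c i)).
  rewrite !Rmult_assoc; apply Rmult_le_compat_l; [assumption|].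
  apply Rle_trans with (INR i * r ^ i); [assumption|].
  apply Rmult_le_compat_l; assumption.
Qed.

(** The quotient of the leading power dominates those of the lower powers, which are smaller by a
    factor of order 1 / r, r being the maximum. *)
Lemma pdivdiff_odd_lower k c : c (S (2 * k)) <> 0 ->
  exists r0 kap, 1 <= r0 /\ 0 < kap /\
    forall t s, r0 <= Rmax (Rabs t) (Rabs s) ->
      kap * Rmax (Rabs t) (Rabs s) ^ (2 * k) <= Rabs (pdivdiff (S (2 * k)) c t s).
Proof.
intros Hc.
destruct (pdivdiff_bound (2 * k) c) as [K [HK HB]].
apply Rabs_pos_lt in Hc.
set (c0 := Rabs (c (S (2 * k)))) in *.
(* Beyond this radius 4 K <= c0 r, so the lower terms use up at most c0 / 4 of the c0 / 2 that the
   leading term provides. *)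
exists (1 + 4 * K / c0), (c0 / 4); repeat split; [|lra|].
- assert (0 <= 4 * K / c0) by (apply Rdiv_le_0_compat; lra); lra.
- intros t s Hr.
  pose proof (divdiff_odd_lower k t s) as HL.
  assert (0 <= 4 * K / c0) by (apply Rdiv_le_0_compat; lra).
  set (r := Rmax (Rabs t) (Rabs s)) in *.
  assert (H1 : 1 <= r) by lra.
  specialize (HB t s r H1 (Rmax_l _ _) (Rmax_r _ _)).
  assert (HK' : 4 * K <= c0 * r).
  { apply Rle_trans with (c0 * (4 * K / c0)); [right; field; lra|].
    apply Rmult_le_compat_l; lra. }
  set (p := r ^ (2 * k)) in *.
  assert (0 <= p) by (apply pow_le; lra).
  change (pdivdiff (S (2 * k)) c t s) with
    (pdivdiff (2 * k) c t s + c (S (2 * k)) * divdiff (S (2 * k)) t s).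
  set (P := pdivdiff (2 * k) c t s) in *.
  set (Q := divdiff (S (2 * k)) t s) in *.
  assert (HQ : c0 * Q <= Rabs (P + c (S (2 * k)) * Q) + Rabs P).
  { apply Rle_trans with (Rabs (c (S (2 * k)) * Q)).
    - rewrite Rabs_mult; fold c0; rewrite (Rabs_pos_eq Q); [lra|].
      fold p in HL; lra.
    - replace (c (S (2 * k)) * Q) with ((P + c (S (2 * k)) * Q) + - P) at 1 by ring.
      rewrite <- (Rabs_Ropp P); apply Rabs_triang. }
  assert (HP : Rabs P <= c0 / 4 * p).
  { apply Rmult_le_reg_r with r; [lra|].
    apply Rle_trans with (1 := HB).
    replace (c0 / 4 * p * r) with ((c0 * r / 4) * p) by field.
    apply Rmult_le_compat_r; lra. }
  nra.
Qed.

(** At each point a single number serves as radius of a neighbourhood and as lower bound of [F] on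
    it; compactness provides a covering for which these numbers stay away from 0. *)
Lemma continuous_2d_lower_bound (F : R -> R -> R) a b :
  (forall x y, continuity_2d_pt F x y) -> (forall x y, 0 < F x y) ->
  exists del, 0 < del /\ forall x y, a <= x <= b -> a <= y <= b -> del <= F x y.
Proof.
intros HF Hpos.
assert (Hloc : forall p : R * R, exists del : posreal,
          forall x y, Rabs (x - fst p) < del -> Rabs (y - snd p) < del -> del <= F x y).
{ intros [u v].
  assert (H2 : 0 < F u v / 2) by (specialize (Hpos u v); lra).
  destruct (HF u v (mkposreal _ H2)) as [del Hdel].
  exists (mkposreal _ (Rmin_stable_in_posreal del (mkposreal _ H2))); simpl.
  intros x y Hx Hy.
  pose proof (Rmin_l del (F u v / 2)); pose proof (Rmin_r del (F u v / 2)).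
  assert (Hd := Hdel x y ltac:(lra) ltac:(lra)); simpl in Hd.
  apply Rabs_def2 in Hd; lra. }
apply functional_choice in Hloc; destruct Hloc as [del Hdel].
destruct (compactness_value_2d a b a b (fun x y => del (x, y))) as [e He].
exists e; split; [apply cond_pos|].
(* The centre near (x, y) is given only under a double negation, hence the argument by
   contradiction. *)
intros x y Hx Hy; apply Rnot_lt_le; intros Hlt.
apply (He x y Hx Hy); intros (u & v & _ & _ & Hu & Hv & Huv).
specialize (Hdel (u, v) x y Hu Hv); lra.
Qed.

(** * Chords of polynomial curves in space *)

Definition R3 : Type := (R * R * R)%type.

(** The l^1 distance: Lipschitz constants of coordinates add up, and chords of a polynomial curve
    factor exactly through divided differences. *)
Definition dist1 (p q : R3) : R :=
  let '(x, y, z) := p in let '(x', y', z') := q in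
  Rabs (x - x') + Rabs (y - y') + Rabs (z - z').

Definition pcurve (d : nat) (a b c : nat -> R) (t : R) : R3 :=
  (fA d a t, gA d b t, hA d c t).

(** Chord length divided by |t - s|, continued to the diagonal by the l^1 norm of the velocity. *)
Definition curve_divdiff d (a b c : nat -> R) t s : R :=
  Rabs (pdivdiff (d - 2) a t s) + Rabs (pdivdiff (d - 1) b t s) + Rabs (pdivdiff d c t s).

Lemma dist1_pcurve d a b c t s :
  dist1 (pcurve d a b c t) (pcurve d a b c s) = Rabs (t - s) * curve_divdiff d a b c t s.
Proof.
unfold dist1, pcurve, curve_divdiff, fA, gA, hA.
rewrite !pdivdiff_spec, !Rabs_mult; ring.
Qed.

Lemma curve_divdiff_cont d a b c t s : continuity_2d_pt (curve_divdiff d a b c) t s.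
Proof.
assert (H : forall n e, continuity_2d_pt (fun t s => Rabs (pdivdiff n e t s)) t s).
{ intros n e; apply (continuity_1d_2d_pt_comp Rabs); [apply Rcontinuity_abs|].
  apply pdivdiff_cont. }
unfold curve_divdiff.
apply (continuity_2d_pt_plus
  (fun t s => Rabs (pdivdiff (d - 2) a t s) + Rabs (pdivdiff (d - 1) b t s)));
  [apply continuity_2d_pt_plus|]; apply H.
Qed.

(** A zero forces equal image points, hence t = s by injectivity; on the diagonal the divided
    differences are derivatives, which do not vanish together. *)
Lemma curve_divdiff_pos d a b c : is_poly_knot d a b c ->
  forall t s, 0 < curve_divdiff d a b c t s.
Proof.
intros [Hinj Himm] t s.
apply Rnot_le_lt; intros H.
unfold curve_divdiff in H.
pose proof (Rabs_pos (pdivdiff (d - 2) a t s)).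
pose proof (Rabs_pos (pdivdiff (d - 1) b t s)).
pose proof (Rabs_pos (pdivdiff d c t s)).
assert (Ha : pdivdiff (d - 2) a t s = 0) by (apply Rabs_eq_0; lra).
assert (Hb : pdivdiff (d - 1) b t s = 0) by (apply Rabs_eq_0; lra).
assert (Hc : pdivdiff d c t s = 0) by (apply Rabs_eq_0; lra).
assert (E : t = s).
{ apply Hinj; unfold fA, gA, hA; apply Rminus_diag_uniq; rewrite pdivdiff_spec;
    (rewrite Ha || rewrite Hb || rewrite Hc); ring. }
subst s.
apply (Himm t _ _ _ (derivable_pt_lim_peval _ a t) (derivable_pt_lim_peval _ b t)
  (derivable_pt_lim_peval _ c t)); auto.
Qed.

(* One of the degrees d - 1, d is odd; the divided difference of an odd power
   of degree n is bounded below by the (n-1)-st power of max(|t|,|s|). *)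
Lemma divdiff_le_at_infinity d a b c :
  (2 <= d)%nat -> b (d - 1)%nat <> 0 -> c d <> 0 ->
  exists r0 C, 1 <= r0 /\ 0 <= C /\
    forall i t s, (i <= d)%nat -> r0 <= Rmax (Rabs t) (Rabs s) ->
      Rabs (divdiff i t s) <= C * curve_divdiff d a b c t s.
Proof.
intros Hd Hb Hc.
destruct d as [|[|m]]; try lia; clear Hd.
replace (S (S m) - 1)%nat with (S m) in Hb by lia.
unfold curve_divdiff; replace (S (S m) - 1)%nat with (S m) by lia.
assert (Hlow : forall i n t s r, (i <= S n)%nat -> 1 <= r -> Rabs t <= r -> Rabs s <= r ->
          Rabs (divdiff i t s) <= INR (S n) * r ^ n).
{ intros i n t s r Hi Hr Ht Hs.
  apply Rmult_le_reg_r with r; [lra|].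
  apply Rle_trans with (1 := divdiff_bound i t s r Ht Hs).
  rewrite Rmult_assoc, (Rmult_comm (r ^ n)); change (r * r ^ n) with (r ^ S n).
  apply Rmult_le_compat; [apply pos_INR|apply pow_le; lra| |].
  - now apply le_INR.
  - now apply Rle_pow. }
destruct (Nat.Even_or_Odd m) as [[k Hk]|[k Hk]].
(* Here d - 1 = m + 1 is odd: the second coordinate controls r^m, hence all powers of degree at most
   d - 1, and only degree d remains. *)
- rewrite Hk in Hb.
  destruct (pdivdiff_odd_lower k b Hb) as (r0 & kap & Hr0 & Hkap & HL).
  rewrite <- Hk in HL.
  destruct (pdivdiff_bound (S m) c) as [K [HK HB]].
  apply Rabs_pos_lt in Hc; set (c0 := Rabs (c (S (S m)))) in *.
  set (N := INR (S m)).
  assert (HN : 0 <= N) by apply pos_INR.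
  assert (HNk : 0 <= N / kap) by (apply Rdiv_le_0_compat; lra).
  assert (HKk : 0 <= K / kap) by (apply Rdiv_le_0_compat; lra).
  assert (HKc : 0 <= (1 + K / kap) / c0) by (apply Rdiv_le_0_compat; lra).
  exists r0, (N / kap + (1 + K / kap) / c0); repeat split; [exact Hr0|lra|].
  intros i t s Hi Hr.
  specialize (HL t s Hr).
  specialize (HB t s (Rmax (Rabs t) (Rabs s)) ltac:(lra) (Rmax_l _ _) (Rmax_r _ _)).
  pose proof (fun j Hj => Hlow j m t s (Rmax (Rabs t) (Rabs s)) Hj ltac:(lra)
    (Rmax_l _ _) (Rmax_r _ _)) as Hq.
  set (r := Rmax (Rabs t) (Rabs s)) in *.
  set (p := r ^ m) in *.
  assert (Hp : 0 <= p) by (apply pow_le; lra).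
  set (X := Rabs (pdivdiff (S (S m) - 2) a t s)).
  set (Y := Rabs (pdivdiff (S m) b t s)) in *.
  set (Z := Rabs (pdivdiff (S (S m)) c t s)) in *.
  assert (0 <= X /\ 0 <= Y /\ 0 <= Z) as (HX & HY & HZ)
    by (repeat split; apply Rabs_pos).
  assert (HpY : p <= Y / kap).
  { apply Rmult_le_reg_l with kap; [lra|].
    replace (kap * (Y / kap)) with Y by (field; lra); exact HL. }
  destruct (Nat.eq_dec i (S (S m))) as [->|Hne].
  (* The top power is isolated in the third coordinate by subtracting the lower terms, which are
     O(r^m) and so controlled by [Y]. *)
  + assert (HZ' : c0 * Rabs (divdiff (S (S m)) t s) <= Z + K * p).
    { assert (HPc : Rabs (pdivdiff (S m) c t s) <= K * p).
      { apply Rmult_le_reg_r with r; [lra|].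
        apply Rle_trans with (1 := HB); right; unfold p; simpl; ring. }
      unfold c0, Z; rewrite <- Rabs_mult.
      replace (c (S (S m)) * divdiff (S (S m)) t s) with
        (pdivdiff (S (S m)) c t s + - pdivdiff (S m) c t s)
        by (unfold pdivdiff; simpl; ring).
      apply Rle_trans with (1 := Rabs_triang _ _).
      rewrite Rabs_Ropp; lra. }
    assert (K * p <= K / kap * Y).
    { replace (K / kap * Y) with (K * (Y / kap)) by (field; lra).
      now apply Rmult_le_compat_l. }
    apply Rle_trans with ((1 + K / kap) / c0 * (X + Y + Z)).
    * apply Rmult_le_reg_l with c0; [exact Hc|].
      replace (c0 * ((1 + K / kap) / c0 * (X + Y + Z)))
        with ((1 + K / kap) * (X + Y + Z)) by (field; lra).
      nra.
    * apply Rmult_le_compat_r; lra.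
  + apply Rle_trans with (1 := Hq i ltac:(lia)); fold N p.
    apply Rle_trans with (N / kap * Y).
    * replace (N / kap * Y) with (N * (Y / kap)) by (field; lra).
      now apply Rmult_le_compat_l.
    * apply Rmult_le_compat; lra.
(* Here d = 2 (k + 1) + 1 is odd, and the third coordinate alone controls r^(d - 1). *)
- replace (S (S m)) with (S (2 * S k)) in Hc by lia.
  destruct (pdivdiff_odd_lower (S k) c Hc) as (r0 & kap & Hr0 & Hkap & HL).
  replace (2 * S k)%nat with (S m) in HL by lia.
  set (N := INR (S (S m))).
  assert (HN : 0 <= N) by apply pos_INR.
  assert (HNk : 0 <= N / kap) by (apply Rdiv_le_0_compat; lra).
  exists r0, (N / kap); repeat split; [exact Hr0|lra|].
  intros i t s Hi Hr.
  specialize (HL t s Hr).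
  pose proof (Hlow i (S m) t s (Rmax (Rabs t) (Rabs s)) Hi ltac:(lra)
    (Rmax_l _ _) (Rmax_r _ _)) as Hq.
  fold N in Hq.
  set (p := Rmax (Rabs t) (Rabs s) ^ S m) in *.
  apply Rle_trans with (1 := Hq).
  pose proof (Rabs_pos (pdivdiff (S (S m) - 2) a t s)).
  pose proof (Rabs_pos (pdivdiff (S m) b t s)).
  apply Rle_trans with (N / kap * Rabs (pdivdiff (S (S m)) c t s)).
  + replace (N * p) with (N / kap * (kap * p)) by (field; lra).
    now apply Rmult_le_compat_l.
  + apply Rmult_le_compat_l; lra.
Qed.

(** Stated for the powers themselves, so that one constant, depending on the knot alone, serves
    every polynomial displacement of degree at most [d]. *)
Lemma pow_sub_le_dist1 d a b c :
  (2 <= d)%nat -> in_Qd d a b c ->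
  exists C, 0 <= C /\ forall i t s, (i <= d)%nat ->
    Rabs (t ^ i - s ^ i) <= C * dist1 (pcurve d a b c t) (pcurve d a b c s).
Proof.
intros Hd (Hk & _ & Hb & Hc).
destruct (divdiff_le_at_infinity d a b c Hd Hb Hc) as (r0 & C & Hr0 & HC & Hinf).
pose proof (curve_divdiff_pos d a b c Hk) as Hpos.
destruct (continuous_2d_lower_bound (curve_divdiff d a b c) (- r0) r0
  (curve_divdiff_cont d a b c) Hpos) as (del & Hdel & Hcpt).
set (M := INR d * r0 ^ d).
assert (HM : 0 <= M) by (apply Rmult_le_pos; [apply pos_INR|apply pow_le; lra]).
assert (HMd : 0 <= M / del) by (apply Rdiv_le_0_compat; lra).
(* [C] handles pairs outside the square of half-width [r0]; inside it [M] bounds the divided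
   differences above and [del] bounds the chord quotient below. *)
exists (C + M / del); split; [lra|].
intros i t s Hi.
rewrite dist1_pcurve, divdiff_spec, Rabs_mult.
rewrite <- Rmult_assoc, (Rmult_comm _ (Rabs (t - s))), Rmult_assoc.
apply Rmult_le_compat_l; [apply Rabs_pos|].
specialize (Hpos t s).
destruct (Rle_dec r0 (Rmax (Rabs t) (Rabs s))) as [Hr|Hr].
- apply Rle_trans with (1 := Hinf i t s Hi Hr).
  apply Rmult_le_compat_r; lra.
- pose proof (Rmax_l (Rabs t) (Rabs s)); pose proof (Rmax_r (Rabs t) (Rabs s)).
  assert (Ht : Rabs t <= r0) by lra.
  assert (Hs : Rabs s <= r0) by lra.
  assert (Hlow : del <= curve_divdiff d a b c t s).
  { apply Hcpt; apply Rabs_le_between; assumption. }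
  apply Rle_trans with M.
  + apply Rle_trans with (Rabs (divdiff i t s) * r0).
    * pose proof (Rabs_pos (divdiff i t s)); nra.
    * apply Rle_trans with (1 := divdiff_bound i t s r0 Ht Hs).
      apply Rmult_le_compat; [apply pos_INR|apply pow_le; lra|now apply le_INR|].
      now apply Rle_pow.
  + replace M with (M / del * del) at 1 by (field; lra).
    apply Rmult_le_compat; lra.
Qed.

(** * Isotopies of the three-sphere *)

Definition origin : R3 := (0, 0, 0).

(** Comparable with sqrt (1 + |p|^2), the factor by which stereographic projection distorts
    chords. *)
Definition weight (p : R3) : R := 1 + dist1 p origin.

Definition padd (p : R3) (k : R) (q : R3) : R3 :=
  let '(x, y, z) := p in let '(x', y', z') := q in (x + k * x', y + k * y', z + k * z').

Lemma dist1_pos p q : 0 <= dist1 p q.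
Proof.
destruct p as [[x y] z], q as [[x' y'] z']; simpl.
pose proof (Rabs_pos (x - x')); pose proof (Rabs_pos (y - y'));
  pose proof (Rabs_pos (z - z')); lra.
Qed.

Lemma dist1_sym p q : dist1 p q = dist1 q p.
Proof.
destruct p as [[x y] z], q as [[x' y'] z']; simpl.
now rewrite (Rabs_minus_sym x), (Rabs_minus_sym y), (Rabs_minus_sym z).
Qed.

Lemma dist1_tri p q r : dist1 p r <= dist1 p q + dist1 q r.
Proof.
destruct p as [[x y] z], q as [[x' y'] z'], r as [[x2 y2] z2]; simpl.
assert (H : forall a b c, Rabs (a - c) <= Rabs (a - b) + Rabs (b - c)).
{ intros a b c; replace (a - c) with ((a - b) + (b - c)) by ring; apply Rabs_triang. }
pose proof (H x x' x2); pose proof (H y y' y2); pose proof (H z z' z2); lra.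
Qed.

Lemma dist1_eq0 p q : dist1 p q <= 0 -> p = q.
Proof.
destruct p as [[x y] z], q as [[x' y'] z']; simpl; intros H.
pose proof (Rabs_pos (x - x')); pose proof (Rabs_pos (y - y'));
  pose proof (Rabs_pos (z - z')).
assert (E : forall a b, Rabs (a - b) <= 0 -> a = b).
{ intros a b Hab; apply Rminus_diag_uniq, Rabs_eq_0.
  pose proof (Rabs_pos (a - b)); lra. }
rewrite (E x x'), (E y y'), (E z z'); [reflexivity|lra..].
Qed.

Lemma weight_ge1 p : 1 <= weight p.
Proof. unfold weight; pose proof (dist1_pos p origin); lra. Qed.

(** Compares two points and two times at once, through k u - l v = k (u - v) + (k - l) v. *)
Lemma dist1_padd p q k l u v :
  dist1 (padd p k u) (padd q l v) <=
  dist1 p q + Rabs k * dist1 u v + Rabs (k - l) * dist1 v origin.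
Proof.
destruct p as [[x y] z], q as [[x' y'] z'], u as [[a b] c], v as [[a' b'] c']; simpl.
assert (H : forall x x' a a', Rabs (x + k * a - (x' + l * a')) <=
          Rabs (x - x') + Rabs k * Rabs (a - a') + Rabs (k - l) * Rabs (a' - 0)).
{ clear; intros x x' a a'.
  replace (x + k * a - (x' + l * a'))
    with ((x - x') + k * (a - a') + (k - l) * (a' - 0)) by ring.
  rewrite <- !Rabs_mult.
  pose proof (Rabs_triang (x - x' + k * (a - a')) ((k - l) * (a' - 0))).
  pose proof (Rabs_triang (x - x') (k * (a - a'))); lra. }
pose proof (H x x' a a'); pose proof (H y y' b b'); pose proof (H z z' c c'); lra.
Qed.

Lemma padd_opp p k u : padd (padd p k u) (- k) u = p.
Proof.
destruct p as [[x y] z], u as [[a b] c]; simpl.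
f_equal; [f_equal|]; ring.
Qed.

(** * Fixed points of contractions and Lipschitz extension *)

Lemma geometric_cv (u : nat -> R) M :
  (forall n, Rabs (u (S n) - u n) <= M * (/ 2) ^ n) -> exists l : R, is_lim_seq u l.
Proof.
intros H.
assert (Hs : ex_series (fun n => u (S n) - u n)).
{ apply (ex_series_le (V := R_CompleteNormedModule) _ (fun n => M * (/ 2) ^ n)); [exact H|].
  apply (ex_series_scal_l M (fun n => (/ 2) ^ n)), ex_series_geom.
  rewrite Rabs_pos_eq; lra. }
destruct Hs as [l Hl].
exists (l + u O).
apply is_lim_seq_incr_1.
apply is_lim_seq_ext with (fun n => sum_n (fun n => u (S n) - u n) n + u O).
- intros n; induction n as [|n IH].
  + rewrite sum_O; ring.
  + rewrite sum_Sn; unfold plus; simpl.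
    rewrite <- IH; ring.
- apply (is_lim_seq_plus' _ _ l (u O)); [exact Hl|apply is_lim_seq_const].
Qed.

(** The iterates of the origin converge coordinate by coordinate, the coordinates being
    1-Lipschitz. *)
Lemma contraction_fixpoint (T : R3 -> R3) :
  (forall p q, dist1 (T p) (T q) <= / 2 * dist1 p q) -> exists p, T p = p.
Proof.
intros HT.
set (x := fix x n := match n with O => origin | S m => T (x m) end).
assert (Hx : forall n, dist1 (x (S n)) (x n) <= dist1 (x 1%nat) (x O) * (/ 2) ^ n).
{ induction n as [|n IH].
  - simpl pow; lra.
  - change (x (S (S n))) with (T (x (S n))); change (x (S n)) with (T (x n)) at 2.
    pose proof (HT (x (S n)) (x n)); simpl pow; lra. }
set (M := dist1 (x 1%nat) (x O)) in *.
assert (Hc : exists p, is_lim_seq (fun n => dist1 (x n) p) 0).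
{ assert (H : forall f : R3 -> R, (forall p q, Rabs (f p - f q) <= dist1 p q) ->
            exists l : R, is_lim_seq (fun n => Rabs (f (x n) - l)) 0).
  { intros f Hf.
    destruct (geometric_cv (fun n => f (x n)) M) as [l Hl].
    - intros n; apply Rle_trans with (1 := Hf _ _), Hx.
    - exists l; apply -> (is_lim_seq_abs_0 (fun n => f (x n) - l)).
      replace (Finite 0) with (Finite (l - l)) by (f_equal; ring).
      apply is_lim_seq_minus'; [exact Hl|apply is_lim_seq_const]. }
  assert (Hpos : forall a, 0 <= Rabs a) by exact Rabs_pos.
  destruct (H (fun p => fst (fst p))) as [l1 H1].
  { intros [[a b] c] [[a' b'] c']; simpl.
    pose proof (Hpos (b - b')); pose proof (Hpos (c - c')); lra. }
  destruct (H (fun p => snd (fst p))) as [l2 H2].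
  { intros [[a b] c] [[a' b'] c']; simpl.
    pose proof (Hpos (a - a')); pose proof (Hpos (c - c')); lra. }
  destruct (H snd) as [l3 H3].
  { intros [[a b] c] [[a' b'] c']; simpl.
    pose proof (Hpos (a - a')); pose proof (Hpos (b - b')); lra. }
  exists (l1, l2, l3).
  apply is_lim_seq_ext with (fun n => Rabs (fst (fst (x n)) - l1) +
    Rabs (snd (fst (x n)) - l2) + Rabs (snd (x n) - l3)).
  - intros n; destruct (x n) as [[a b] c]; reflexivity.
  - replace (Finite 0) with (Finite (0 + 0 + 0)) by (f_equal; ring).
    apply is_lim_seq_plus'; [apply is_lim_seq_plus'|]; assumption. }
destruct Hc as [p Hp].
exists p; apply dist1_eq0.
(* Passage to the limit in |T p - p| <= |x_n - p| / 2 + |x_(n+1) - p|. *)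
apply (is_lim_seq_le (fun _ => dist1 (T p) p)
  (fun n => / 2 * dist1 (x n) p + dist1 (x (S n)) p) (dist1 (T p) p) 0).
- intros n; apply Rle_trans with (1 := dist1_tri _ (T (x n)) _).
  pose proof (HT p (x n)) as H; rewrite (dist1_sym p (x n)) in H.
  change (x (S n)) with (T (x n)); lra.
- apply is_lim_seq_const.
- replace (Finite 0) with (Finite (/ 2 * 0 + 0)) by (f_equal; ring).
  apply is_lim_seq_plus'.
  + apply (is_lim_seq_scal_l _ (/ 2) 0), Hp.
  + now apply (is_lim_seq_incr_1 (fun n => dist1 (x n) p)).
Qed.

(** V p is the supremum over t of v t - L |p - phi t|; by the Lipschitz hypothesis it is attained at
    the index t when p = phi t. The index [i0] makes the set of values nonempty and bounds it. *)
Lemma mcshane_extension (I : Type) (i0 : I) (phi : I -> R3) (v : I -> R) (L : R) :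
  0 <= L -> (forall t s, Rabs (v t - v s) <= L * dist1 (phi t) (phi s)) ->
  exists V : R3 -> R, (forall t, V (phi t) = v t) /\
    (forall p q, Rabs (V p - V q) <= L * dist1 p q).
Proof.
intros HL Hv.
assert (Hub : forall p s t, v t - L * dist1 p (phi t) <= v s + L * dist1 p (phi s)).
{ intros p s t.
  pose proof (Rle_abs (v t - v s)); pose proof (Hv t s).
  pose proof (dist1_tri (phi t) p (phi s)); pose proof (dist1_sym p (phi t)).
  nra. }
assert (Hex : forall p, exists m,
          is_lub (fun x => exists t, x = v t - L * dist1 p (phi t)) m).
{ intros p.
  destruct (completeness (fun x => exists t, x = v t - L * dist1 p (phi t))) as [m Hm].
  - exists (v i0 + L * dist1 p (phi i0)); intros x [t ->]; apply Hub.
  - now exists (v i0 - L * dist1 p (phi i0)), i0.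
  - now exists m. }
apply functional_choice in Hex; destruct Hex as [V HV].
exists V; split.
- intros t; destruct (HV (phi t)) as [H1 H2].
  assert (H0 : dist1 (phi t) (phi t) = 0)
    by (destruct (phi t) as [[x y] z]; simpl; rewrite !Rminus_eq_0, Rabs_R0; ring).
  apply Rle_antisym.
  + apply H2; intros x [s ->].
    pose proof (Hub (phi t) t s); rewrite H0 in *; lra.
  + apply H1; exists t; rewrite H0; ring.
- assert (H : forall p q, V p - V q <= L * dist1 p q).
  { intros p q; destruct (HV p) as [_ H2], (HV q) as [H1 _].
    apply Rle_minus_l, H2; intros x [t ->].
    assert (Hq : v t - L * dist1 q (phi t) <= V q) by (apply H1; now exists t).
    pose proof (dist1_tri q p (phi t)); pose proof (dist1_sym p q); nra. }
  intros p q; apply Rabs_le; pose proof (H p q); pose proof (H q p) as H'.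
  rewrite (dist1_sym q p) in H'; lra.
Qed.

(** * Stereographic projection and the chordal metric *)

Definition stereo (p : R4) : R3 :=
  let '(x1, x2, x3, x4) := p in (x1 / (1 - x4), x2 / (1 - x4), x3 / (1 - x4)).

Definition inv_stereo (p : R3) : R4 := let '(x, y, z) := p in inv_stereo3 x y z.

(** Extends [G] by fixing the point at infinity; on the sphere the last coordinate is 1 only at
    [N3]. *)
Definition lift (G : R3 -> R3) (p : R4) : R4 :=
  if Req_EM_T (snd p) 1 then N3 else inv_stereo (G (stereo p)).

Lemma sqnorm_pos x y z : 0 < x ^ 2 + y ^ 2 + z ^ 2 + 1.
Proof. nra. Qed.

Lemma S3_N3 : S3 N3.
Proof. simpl; ring. Qed.

Lemma S3_inv_stereo p : S3 (inv_stereo p).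
Proof.
destruct p as [[x y] z]; unfold inv_stereo, inv_stereo3, S3; cbv zeta.
pose proof (sqnorm_pos x y z); field; lra.
Qed.

Lemma snd_inv_stereo p : snd (inv_stereo p) <> 1.
Proof.
destruct p as [[x y] z]; unfold inv_stereo, inv_stereo3; cbv zeta; cbn [snd].
pose proof (sqnorm_pos x y z) as H; set (r := x ^ 2 + y ^ 2 + z ^ 2) in *.
intros E.
assert (E' : (r - 1) / (r + 1) * (r + 1) = r + 1) by (rewrite E; ring).
unfold Rdiv in E'; rewrite Rmult_assoc, Rinv_l in E'; lra.
Qed.

Lemma stereo_inv_stereo p : stereo (inv_stereo p) = p.
Proof.
destruct p as [[x y] z]; unfold inv_stereo, inv_stereo3, stereo; cbv zeta.
pose proof (sqnorm_pos x y z) as H; set (r := x ^ 2 + y ^ 2 + z ^ 2) in *.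
replace (1 - (r - 1) / (r + 1)) with (2 / (r + 1)) by (field; lra).
f_equal; [f_equal|]; field; lra.
Qed.

Lemma S3_cases p : S3 p -> p = N3 \/ exists q, p = inv_stereo q.
Proof.
destruct p as [[[x y] z] w]; unfold S3; intros H.
destruct (Req_EM_T w 1) as [->|Hw]; [left|right].
- assert (x = 0 /\ y = 0 /\ z = 0) as (-> & -> & ->) by (repeat split; nra).
  reflexivity.
- assert (Hw' : 1 - w <> 0) by lra.
  exists (stereo (x, y, z, w)); unfold inv_stereo, inv_stereo3, stereo; cbv zeta.
  replace ((x / (1 - w)) ^ 2 + (y / (1 - w)) ^ 2 + (z / (1 - w)) ^ 2)
    with ((1 + w) / (1 - w)).
  + f_equal; [f_equal; [f_equal|]|]; field; lra.
  + transitivity ((x ^ 2 + y ^ 2 + z ^ 2) / (1 - w) ^ 2).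
    * replace (x ^ 2 + y ^ 2 + z ^ 2) with ((1 - w) * (1 + w)) by lra; field; lra.
    * field; lra.
Qed.

Lemma lift_N3 G : lift G N3 = N3.
Proof. unfold lift; simpl; destruct (Req_EM_T 1 1); [reflexivity|lra]. Qed.

Lemma lift_inv_stereo G p : lift G (inv_stereo p) = inv_stereo (G p).
Proof.
unfold lift; destruct (Req_EM_T (snd (inv_stereo p)) 1) as [E|_].
- now apply snd_inv_stereo in E.
- now rewrite stereo_inv_stereo.
Qed.

Lemma S3_lift G p : S3 (lift G p).
Proof.
unfold lift; destruct (Req_EM_T (snd p) 1); [apply S3_N3|apply S3_inv_stereo].
Qed.

Lemma lift_cancel G K : (forall p, G (K p) = p) -> forall p, S3 p -> lift G (lift K p) = p.
Proof.
intros H p Hp; destruct (S3_cases p Hp) as [->|[q ->]].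
- now rewrite !lift_N3.
- now rewrite !lift_inv_stereo, H.
Qed.

Lemma lift_id G : (forall p, G p = p) -> forall p, S3 p -> lift G p = p.
Proof.
intros H p Hp; destruct (S3_cases p Hp) as [->|[q ->]].
- now rewrite lift_N3.
- now rewrite lift_inv_stereo, H.
Qed.

(** The upper bound is Cauchy-Schwarz for the four entries 1, |x|, |y|, |z|. *)
Lemma weight_sqr x y z :
  x ^ 2 + y ^ 2 + z ^ 2 + 1 <= weight (x, y, z) ^ 2 <= 4 * (x ^ 2 + y ^ 2 + z ^ 2 + 1).
Proof.
unfold weight, dist1, origin; rewrite !Rminus_0_r.
rewrite <- (pow2_abs x), <- (pow2_abs y), <- (pow2_abs z).
pose proof (Rabs_pos x); pose proof (Rabs_pos y); pose proof (Rabs_pos z).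
set (a := Rabs x) in *; set (b := Rabs y) in *; set (c := Rabs z) in *.
split; [nra|].
pose proof (pow2_ge_0 (a - b)); pose proof (pow2_ge_0 (a - c));
pose proof (pow2_ge_0 (b - c)); pose proof (pow2_ge_0 (a - 1));
pose proof (pow2_ge_0 (b - 1)); pose proof (pow2_ge_0 (c - 1)); nra.
Qed.

Lemma dist1_sqr x y z x' y' z' :
  (x - x') ^ 2 + (y - y') ^ 2 + (z - z') ^ 2 <= dist1 (x, y, z) (x', y', z') ^ 2 <=
  3 * ((x - x') ^ 2 + (y - y') ^ 2 + (z - z') ^ 2).
Proof.
unfold dist1.
rewrite <- (pow2_abs (x - x')), <- (pow2_abs (y - y')), <- (pow2_abs (z - z')).
pose proof (Rabs_pos (x - x')); pose proof (Rabs_pos (y - y'));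
  pose proof (Rabs_pos (z - z')).
set (a := Rabs (x - x')) in *; set (b := Rabs (y - y')) in *;
  set (c := Rabs (z - z')) in *.
split; [nra|].
pose proof (pow2_ge_0 (a - b)); pose proof (pow2_ge_0 (a - c));
pose proof (pow2_ge_0 (b - c)); nra.
Qed.

Lemma dist4_sym p q : dist4 p q = dist4 q p.
Proof.
destruct p as [[[x y] z] w], q as [[[x' y'] z'] w']; unfold dist4; f_equal; ring.
Qed.

Lemma sqrt_between a b E : 0 <= a -> 0 <= b -> a ^ 2 <= E <= b ^ 2 -> a <= sqrt E <= b.
Proof.
intros Ha Hb [H1 H2].
rewrite <- (sqrt_pow2 a Ha), <- (sqrt_pow2 b Hb) at 1.
split; now apply sqrt_le_1_alt.
Qed.

(** The chordal distance up to bounded factors, free of square roots. *)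
Definition chord1 (p q : R3) : R := dist1 p q / (weight p * weight q).

(* The Euclidean chordal metric is 2 |p - q| / sqrt ((1 + |p|^2) (1 + |q|^2)). *)
Lemma dist4_inv_stereo p q :
  chord1 p q <= dist4 (inv_stereo p) (inv_stereo q) <= 8 * chord1 p q.
Proof.
pose proof (weight_ge1 p) as Hp; pose proof (weight_ge1 q) as Hq.
pose proof (dist1_pos p q) as Hd.
assert (Hc : 0 <= chord1 p q) by (apply Rdiv_le_0_compat; [lra|nra]).
destruct p as [[x y] z], q as [[x' y'] z'].
unfold inv_stereo, inv_stereo3, dist4; cbv zeta.
apply sqrt_between; [exact Hc|lra|].
pose proof (weight_sqr x y z) as Wp; pose proof (weight_sqr x' y' z') as Wq.
pose proof (dist1_sqr x y z x' y' z') as D.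
pose proof (sqnorm_pos x y z) as HA; pose proof (sqnorm_pos x' y' z') as HB.
match goal with |- _ <= ?e <= _ =>
  replace e with (4 * ((x - x') ^ 2 + (y - y') ^ 2 + (z - z') ^ 2) /
    ((x ^ 2 + y ^ 2 + z ^ 2 + 1) * (x' ^ 2 + y' ^ 2 + z' ^ 2 + 1)))
    by (field; lra) end.
unfold chord1.
set (wp := weight (x, y, z)) in *; set (wq := weight (x', y', z')) in *.
set (e := dist1 (x, y, z) (x', y', z')) in *.
set (A := x ^ 2 + y ^ 2 + z ^ 2 + 1) in *; set (B := x' ^ 2 + y' ^ 2 + z' ^ 2 + 1) in *.
set (E := (x - x') ^ 2 + (y - y') ^ 2 + (z - z') ^ 2) in *.
(* The lower bound uses e^2 <= 3 E <= 4 E; the constant 8 satisfies 8^2 = 4 * 16, the 16 being a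
   factor 4 for each squared weight. *)
replace ((e / (wp * wq)) ^ 2) with (e ^ 2 * / (wp ^ 2 * wq ^ 2)) by (field; lra).
replace ((8 * (e / (wp * wq))) ^ 2) with (4 * e ^ 2 * (16 * / (wp ^ 2 * wq ^ 2)))
  by (field; lra).
assert (HE : 0 <= E).
{ pose proof (pow2_ge_0 (x - x')); pose proof (pow2_ge_0 (y - y'));
  pose proof (pow2_ge_0 (z - z')); unfold E; lra. }
assert (HAB : 0 < A * B) by now apply Rmult_lt_0_compat.
assert (Hw1 : A * B <= wp ^ 2 * wq ^ 2) by (apply Rmult_le_compat; lra).
assert (Hw2 : wp ^ 2 * wq ^ 2 <= 16 * (A * B)).
{ replace (16 * (A * B)) with ((4 * A) * (4 * B)) by ring.
  apply Rmult_le_compat; try apply pow2_ge_0; lra. }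
set (W := wp ^ 2 * wq ^ 2) in *.
assert (HW : 0 < / W) by (apply Rinv_0_lt_compat; lra).
unfold Rdiv; split.
- apply Rmult_le_compat; [apply pow2_ge_0|lra|lra|].
  now apply Rinv_le_contravar.
- apply Rmult_le_compat; [lra| |lra|].
  + left; now apply Rinv_0_lt_compat.
  + apply Rmult_le_reg_l with (A * B); [exact HAB|].
    rewrite Rinv_r by lra.
    replace (A * B * (16 * / W)) with ((16 * (A * B)) * / W) by ring.
    apply Rmult_le_reg_r with W; [lra|].
    rewrite Rmult_assoc, Rinv_l by lra; lra.
Qed.

(** The Euclidean chordal distance to the pole is 2 / sqrt (1 + |p|^2). *)
Lemma dist4_inv_stereo_N3 p :
  / weight p <= dist4 (inv_stereo p) N3 <= 4 * / weight p.
Proof.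
pose proof (weight_ge1 p) as Hp.
assert (Hi : 0 < / weight p) by (apply Rinv_0_lt_compat; lra).
destruct p as [[x y] z].
unfold inv_stereo, inv_stereo3, dist4, N3; cbv zeta.
apply sqrt_between; [lra|lra|].
pose proof (weight_sqr x y z) as Wp.
pose proof (sqnorm_pos x y z) as HA.
match goal with |- _ <= ?e <= _ =>
  replace e with (4 / (x ^ 2 + y ^ 2 + z ^ 2 + 1)) by (field; lra) end.
set (w := weight (x, y, z)) in *.
set (A := x ^ 2 + y ^ 2 + z ^ 2 + 1) in *.
split.
- rewrite pow_inv; apply Rle_trans with (/ A).
  + now apply Rinv_le_contravar.
  + pose proof (Rinv_0_lt_compat A HA); unfold Rdiv; lra.
- replace ((4 * / w) ^ 2) with (16 * / w ^ 2) by (field; lra).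
  assert (0 < w ^ 2) by lra.
  apply Rmult_le_reg_r with (w ^ 2); [lra|].
  rewrite Rmult_assoc, Rinv_l by lra.
  apply Rmult_le_reg_l with A; [exact HA|].
  replace (A * (4 / A * w ^ 2)) with (4 * w ^ 2) by (field; lra); lra.
Qed.

(* The growth condition, saying that the maps extend continuously by fixing
   infinity, together with the Lipschitz condition gives a Lipschitz bound for
   the chordal metric. *)
Lemma lift_lipschitz (G G' : R3 -> R3) L k :
  1 <= L -> 0 <= k ->
  (forall p, weight p <= L * weight (G p)) ->
  (forall p, weight p <= L * weight (G' p)) ->
  (forall p q, dist1 (G p) (G' q) <= L * (dist1 p q + k * weight q)) ->
  forall x y, S3 x -> S3 y ->
    dist4 (lift G x) (lift G' y) <= 8 * L ^ 3 * (dist4 x y + k).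
Proof.
intros HL Hk HG HG' HGG x y Hx Hy.
assert (HL3 : L <= L ^ 3).
{ assert (1 <= L * L) by nra; simpl; nra. }
(* The growth condition read for the reciprocal weights that occur in the chordal metric. *)
assert (Hinv : forall w w', 1 <= w -> 1 <= w' -> w <= L * w' -> / w' <= L * / w).
{ intros w w' Hw Hw' H; apply Rmult_le_reg_l with w'; [lra|].
  rewrite Rinv_r by lra; apply Rmult_le_reg_r with w; [lra|].
  replace (w' * (L * / w) * w) with (L * w') by (field; lra); lra. }
assert (HN : forall G p, (forall p, weight p <= L * weight (G p)) ->
          dist4 (inv_stereo (G p)) N3 <= 8 * L ^ 3 * (dist4 (inv_stereo p) N3 + k)).
{ intros F p HF.
  pose proof (dist4_inv_stereo_N3 (F p)) as [_ H1].
  pose proof (dist4_inv_stereo_N3 p) as [H2 _].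
  pose proof (Hinv _ _ (weight_ge1 p) (weight_ge1 (F p)) (HF p)).
  pose proof (weight_ge1 p).
  assert (0 < / weight p) by (apply Rinv_0_lt_compat; lra).
  apply Rle_trans with (4 * L * / weight p); [lra|].
  apply Rmult_le_compat; lra. }
destruct (S3_cases x Hx) as [->|[p ->]], (S3_cases y Hy) as [->|[q ->]];
  rewrite ?lift_N3, ?lift_inv_stereo.
- assert (E : dist4 N3 N3 = 0).
  { unfold dist4, N3; rewrite <- sqrt_0; f_equal; ring. }
  rewrite E; apply Rmult_le_pos; lra.
- rewrite (dist4_sym N3), (dist4_sym N3); now apply HN.
- now apply HN.
- pose proof (dist4_inv_stereo (G p) (G' q)) as [_ H1].
  pose proof (dist4_inv_stereo p q) as [H2 _].
  apply Rle_trans with (1 := H1).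
  rewrite Rmult_assoc; apply Rmult_le_compat_l; [lra|].
  apply Rle_trans with (L ^ 3 * (chord1 p q + k)); [|apply Rmult_le_compat_l; lra].
  pose proof (weight_ge1 p) as Wp; pose proof (weight_ge1 q) as Wq.
  pose proof (weight_ge1 (G p)) as Wp'; pose proof (weight_ge1 (G' q)) as Wq'.
  pose proof (Hinv _ _ Wp Wp' (HG p)) as Ip; pose proof (Hinv _ _ Wq Wq' (HG' q)) as Iq.
  pose proof (Rinv_0_lt_compat (weight p) ltac:(lra)).
  pose proof (Rinv_0_lt_compat (weight q) ltac:(lra)).
  pose proof (Rinv_0_lt_compat (weight (G p)) ltac:(lra)).
  pose proof (Rinv_0_lt_compat (weight (G' q)) ltac:(lra)).
  pose proof (dist1_pos p q); pose proof (dist1_pos (G p) (G' q)).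
  unfold chord1 at 1; unfold Rdiv; rewrite Rinv_mult.
  apply Rle_trans with (L * (dist1 p q + k * weight q) *
    ((L * / weight p) * (L * / weight q))).
  + apply Rmult_le_compat; [assumption| |apply HGG|].
    * apply Rmult_le_pos; lra.
    * apply Rmult_le_compat; lra.
  (* The distance and the two reciprocal weights contribute one factor [L] each; [weight q] cancels
     in the term with [k], leaving k / weight p <= k. *)
  + replace (L * (dist1 p q + k * weight q) * (L * / weight p * (L * / weight q)))
      with (L ^ 3 * (chord1 p q + k * / weight p)) by (unfold chord1; field; lra).
    apply Rmult_le_compat_l; [lra|].
    assert (/ weight p <= 1).
    { rewrite <- Rinv_1; apply Rinv_le_contravar; lra. }
    nra.
Qed.

(** * Isotopies from Lipschitz displacements *)

Definition ext_curve (phi : R -> R3) (p : R * R) : R4 :=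
  let '(u, v) := p in
  match Req_EM_T v 1 with
  | left _ => N3
  | right _ => inv_stereo (phi (u / (1 - v)))
  end.

Lemma cont_S3_lift (G : R3 -> R3) L :
  1 <= L -> (forall p, weight p <= L * weight (G p)) ->
  (forall p q, dist1 (G p) (G q) <= L * dist1 p q) -> cont_S3 (lift G).
Proof.
intros HL Hw HG x Hx eps Heps.
assert (H3 : 0 < 8 * L ^ 3) by (assert (0 < L ^ 3) by (apply pow_lt; lra); lra).
exists (eps / (8 * L ^ 3)); split; [now apply Rdiv_lt_0_compat|].
intros y Hy Hyx.
apply Rle_lt_trans with (8 * L ^ 3 * (dist4 y x + 0)).
- apply lift_lipschitz; try assumption; [lra|].
  intros p q; rewrite Rmult_0_l, Rplus_0_r; apply HG.
- rewrite Rplus_0_r.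
  replace eps with (8 * L ^ 3 * (eps / (8 * L ^ 3))) by (field; lra).
  now apply Rmult_lt_compat_l.
Qed.

(** The isotopy is p + s V p. Since s V is 1/2-Lipschitz, distances shrink at most by a factor 2,
    and surjectivity follows from the contraction principle; linear growth of [V] keeps infinity
    under control. *)
Lemma ambient_isotopic_displacement (phi psi : R -> R3) (V : R3 -> R3) :
  (forall p q, dist1 (V p) (V q) <= / 2 * dist1 p q) ->
  (forall t, psi t = padd (phi t) 1 (V (phi t))) ->
  ambient_isotopic (ext_curve phi) (ext_curve psi).
Proof.
intros HV Hpsi.
set (v0 := dist1 (V origin) origin).
assert (Hv0 : 0 <= v0) by apply dist1_pos.
(* Large enough for the Lipschitz constant 3/2, for the growth of [V] and for |p| <= 2 |H s p| + 2
   v0. *)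
set (L := 2 + 2 * v0).
set (H := fun s p => padd p s (V p)).
assert (HVn : forall p, dist1 (V p) origin <= / 2 * dist1 p origin + v0).
{ intros p; pose proof (dist1_tri (V p) (V origin) origin).
  pose proof (HV p origin); unfold v0; lra. }
assert (HVw : forall p, dist1 (V p) origin <= L * weight p).
{ intros p; pose proof (HVn p); pose proof (dist1_pos p origin).
  unfold weight, L; nra. }
assert (Hlip : forall s s' p q, 0 <= s <= 1 ->
          dist1 (H s p) (H s' q) <= L * (dist1 p q + Rabs (s - s') * weight q)).
{ intros s s' p q Hs.
  apply Rle_trans with (1 := dist1_padd _ _ _ _ _ _).
  rewrite (Rabs_pos_eq s) by lra.
  pose proof (HV p q); pose proof (HVw q); pose proof (dist1_pos p q).
  pose proof (dist1_pos (V p) (V q)); pose proof (Rabs_pos (s - s')).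
  assert (s * dist1 (V p) (V q) <= / 2 * dist1 p q) by nra.
  assert (Rabs (s - s') * dist1 (V q) origin <= Rabs (s - s') * (L * weight q))
    by now apply Rmult_le_compat_l.
  assert (3 / 2 * dist1 p q <= L * dist1 p q)
    by (apply Rmult_le_compat_r; unfold L; lra).
  lra. }
(* Writing p as H s p - s V p gives |p - q| <= |H s p - H s q| + |p - q| / 2. *)
assert (Hexp : forall s p q, 0 <= s <= 1 -> dist1 p q <= 2 * dist1 (H s p) (H s q)).
{ intros s p q Hs.
  pose proof (dist1_padd (H s p) (H s q) (- s) (- s) (V p) (V q)) as E.
  unfold H in E at 1 2; rewrite !padd_opp, Rminus_eq_0, Rabs_R0, Rabs_Ropp in E.
  rewrite (Rabs_pos_eq s) in E by lra.
  pose proof (HV p q); pose proof (dist1_pos (V p) (V q)); nra. }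
assert (Hweight : forall s p, 0 <= s <= 1 -> weight p <= L * weight (H s p)).
{ intros s p Hs.
  pose proof (Hexp s p origin Hs).
  pose proof (dist1_tri (H s p) origin (H s origin)).
  pose proof (dist1_pos (H s p) origin).
  assert (dist1 origin (H s origin) <= v0).
  { rewrite dist1_sym; unfold v0, H, padd, origin, dist1.
    destruct (V (0, 0, 0)) as [[a b] c].
    rewrite !Rplus_0_l, !Rminus_0_r, !Rabs_mult, !(Rabs_pos_eq s) by lra.
    pose proof (Rabs_pos a); pose proof (Rabs_pos b); pose proof (Rabs_pos c); nra. }
  unfold weight, L; nra. }
assert (HL : 1 <= L) by (unfold L; lra).
assert (H3 : 0 < 8 * L ^ 3) by (assert (0 < L ^ 3) by (apply pow_lt; lra); lra).
exists (fun s => lift (H s)); repeat split.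
- intros; apply S3_lift.
- intros s x Hs Hx eps Heps.
  (* Half of the tolerance is for space, half for time. *)
  exists (eps / (8 * L ^ 3) / 2); split.
  + apply Rdiv_lt_0_compat; [now apply Rdiv_lt_0_compat|lra].
  + intros s' y Hs' Hy Hss Hyx.
    apply Rle_lt_trans with (8 * L ^ 3 * (dist4 y x + Rabs (s' - s))).
    * apply lift_lipschitz; try assumption; [apply Rabs_pos| | |]; intros.
      -- now apply Hweight.
      -- now apply Hweight.
      -- now apply Hlip.
    * replace eps with (8 * L ^ 3 * (eps / (8 * L ^ 3))) at 1 by (field; lra).
      apply Rmult_lt_compat_l; lra.
- apply cont_S3_lift with L; [exact HL|intros; now apply Hweight|].
  intros p q; pose proof (Hlip s s p q ltac:(assumption)) as E.
  now rewrite Rminus_eq_0, Rabs_R0, Rmult_0_l, Rplus_0_r in E.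
- rename H0 into Hs.
  (* A solution p is a fixed point of the contraction sending p to y - s V p. *)
  assert (Hsurj : forall y, exists p, H s p = y).
  { intros y.
    destruct (contraction_fixpoint (fun p => padd y (- s) (V p))) as [p Hp].
    - intros p q; apply Rle_trans with (1 := dist1_padd _ _ _ _ _ _).
      rewrite Rminus_eq_0, Rabs_R0, Rabs_Ropp, (Rabs_pos_eq s) by lra.
      assert (dist1 y y <= 0)
        by (destruct y as [[a b] c]; simpl; rewrite !Rminus_eq_0, Rabs_R0; lra).
      pose proof (HV p q); pose proof (dist1_pos (V p) (V q)); nra.
    - exists p; unfold H; rewrite <- Hp at 1.
      rewrite <- (Ropp_involutive s) at 2; apply padd_opp. }
  apply functional_choice in Hsurj; destruct Hsurj as [K HK].
  assert (HK' : forall p, K (H s p) = p).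
  { intros p; apply dist1_eq0.
    apply Rle_trans with (1 := Hexp s _ _ Hs); rewrite HK.
    destruct (H s p) as [[a b] c]; simpl; rewrite !Rminus_eq_0, Rabs_R0; lra. }
  exists (lift K); repeat split.
  + intros; apply S3_lift.
  + now apply lift_cancel.
  + now apply lift_cancel.
  (* The inverse is 2-Lipschitz by [Hexp], and p = K p + s V (K p) gives weight p <= (1 + L) weight
     (K p). *)
  + apply cont_S3_lift with (2 * L); [lra| |].
    * intros p; rewrite <- (HK p) at 1.
      pose proof (HVw (K p)) as E1.
      pose proof (dist1_tri (H s (K p)) (K p) origin) as E2.
      assert (E3 : dist1 (H s (K p)) (K p) <= dist1 (V (K p)) origin).
      { unfold H, padd, dist1, origin.
        destruct (K p) as [[x y] z], (V (x, y, z)) as [[a b] c].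
        rewrite !Rminus_0_r, !(Rplus_comm _ (s * _)); unfold Rminus.
        rewrite !Rplus_assoc, !Rplus_opp_r, !Rplus_0_r.
        rewrite !Rabs_mult, !(Rabs_pos_eq s) by lra.
        pose proof (Rabs_pos a); pose proof (Rabs_pos b); pose proof (Rabs_pos c); nra. }
      pose proof (weight_ge1 (K p)).
      assert (weight (K p) <= L * weight (K p)) by nra.
      unfold weight at 1; unfold weight in H1 at 1; lra.
    * intros p q; rewrite <- (HK p) at 2; rewrite <- (HK q) at 2.
      pose proof (Hexp s (K p) (K q) Hs).
      pose proof (dist1_pos (H s (K p)) (H s (K q))); nra.
- apply lift_id; intros [[x y] z]; unfold H, padd.
  destruct (V (x, y, z)) as [[a b] c]; f_equal; [f_equal|]; ring.
- intros [u v] _; unfold ext_curve.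
  destruct (Req_EM_T v 1); [now rewrite lift_N3|].
  now rewrite lift_inv_stereo, Hpsi.
Qed.

(** Both isotopies run simultaneously, so no two time intervals have to be glued. *)
Lemma ambient_isotopic_trans F G K :
  (forall p, S1 p -> S3 (F p)) ->
  ambient_isotopic F G -> ambient_isotopic G K -> ambient_isotopic F K.
Proof.
intros HF (H & HS & HC & HI & H0 & H1) (H' & HS' & HC' & HI' & H0' & H1').
exists (fun s x => H' s (H s x)); repeat split.
- intros; now apply HS'; [|apply HS].
- intros s x Hs Hx eps Heps.
  destruct (HC' s (H s x) Hs (HS s x Hs Hx) eps Heps) as (d1 & Hd1 & E1).
  destruct (HC s x Hs Hx d1 Hd1) as (d2 & Hd2 & E2).
  exists (Rmin d1 d2); split; [now apply Rmin_pos|].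
  intros s' y Hs' Hy Hss Hyx.
  pose proof (Rmin_l d1 d2); pose proof (Rmin_r d1 d2).
  apply E1; [assumption|now apply HS|lra|].
  apply E2; try assumption; lra.
- intros x Hx eps Heps.
  destruct (HI' s ltac:(assumption)) as [C' _], (HI s ltac:(assumption)) as [C _].
  destruct (C' (H s x) (HS s x ltac:(assumption) Hx) eps Heps) as (d1 & Hd1 & E1).
  destruct (C x Hx d1 Hd1) as (d2 & Hd2 & E2).
  exists d2; split; [assumption|]; intros y Hy Hyx.
  apply E1; [now apply HS|now apply E2].
- destruct (HI' s ltac:(assumption)) as (_ & J' & A1 & A2 & A3 & A4).
  destruct (HI s ltac:(assumption)) as (_ & J & B1 & B2 & B3 & B4).
  exists (fun x => J (J' x)); repeat split.
  + intros x Hx; now apply B1, A1.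
  + intros x Hx; rewrite A2; [now apply B2|now apply HS].
  + intros x Hx; rewrite B3; [now apply A3|now apply A1].
  + intros x Hx eps Heps.
    destruct (B4 (J' x) (A1 x Hx) eps Heps) as (d1 & Hd1 & E1).
    destruct (A4 x Hx d1 Hd1) as (d2 & Hd2 & E2).
    exists d2; split; [assumption|]; intros y Hy Hyx.
    apply E1; [now apply A1|now apply E2].
- intros x Hx; rewrite H0 by assumption; now apply H0'.
- intros p Hp; rewrite H1' by assumption; now rewrite H1.
Qed.

(** Each component is extended separately with constant 1/6; in the l^1 distance the three add up to
    1/2. *)
Lemma ambient_isotopic_lipschitz_close (phi psi : R -> R3) (v1 v2 v3 : R -> R) :
  (forall t, psi t = padd (phi t) 1 (v1 t, v2 t, v3 t)) ->
  (forall v, v = v1 \/ v = v2 \/ v = v3 ->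
     forall t s, Rabs (v t - v s) <= / 6 * dist1 (phi t) (phi s)) ->
  ambient_isotopic (ext_curve phi) (ext_curve psi).
Proof.
intros Hpsi H.
destruct (mcshane_extension R 0 phi v1 (/ 6) ltac:(lra) (H v1 ltac:(auto)))
  as (V1 & E1 & L1).
destruct (mcshane_extension R 0 phi v2 (/ 6) ltac:(lra) (H v2 ltac:(auto)))
  as (V2 & E2 & L2).
destruct (mcshane_extension R 0 phi v3 (/ 6) ltac:(lra) (H v3 ltac:(auto)))
  as (V3 & E3 & L3).
apply ambient_isotopic_displacement with (fun p => (V1 p, V2 p, V3 p)).
- intros p q; unfold dist1 at 1.
  pose proof (L1 p q); pose proof (L2 p q); pose proof (L3 p q); lra.
- intros t; now rewrite E1, E2, E3, Hpsi.
Qed.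

(** * Paths of knots *)

(** Connectedness of [0,1] for a locally constant property: [P] reaches the supremum [m] of the
    points where it holds, and would pass beyond [m] if m < 1. *)
Lemma interval_induction (P : R -> Prop) :
  P 0 ->
  (forall s, 0 <= s <= 1 -> exists del, 0 < del /\
     forall s', 0 <= s' <= 1 -> Rabs (s' - s) < del -> (P s <-> P s')) ->
  P 1.
Proof.
intros H0 Hloc.
destruct (completeness (fun s => 0 <= s <= 1 /\ P s)) as [m [Hm1 Hm2]].
- exists 1; intros s [Hs _]; lra.
- exists 0; split; [lra|exact H0].
- assert (Hm : 0 <= m <= 1).
  { split; [apply Hm1; split; [lra|exact H0]|apply Hm2; intros s [Hs _]; lra]. }
  destruct (Hloc m Hm) as (del & Hdel & HP).
  assert (Hs : exists s, (0 <= s <= 1 /\ P s) /\ m - del < s).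
  { apply Classical_Prop.NNPP; intros Hn.
    assert (m <= m - del); [|lra].
    apply Hm2; intros s Hs; apply Rnot_lt_le; intros Hlt; apply Hn; now exists s. }
  destruct Hs as (s & [Hs HPs] & Hms).
  assert (s <= m) by (now apply Hm1).
  assert (HPm : P m).
  { apply (HP s Hs); [|exact HPs].
    rewrite Rabs_left1; lra. }
  destruct (Rlt_dec m 1) as [Hlt|Hge].
  + pose proof (Rmin_l (m + del / 2) 1); pose proof (Rmin_r (m + del / 2) 1).
    assert (Hmin : m < Rmin (m + del / 2) 1) by (apply Rmin_glb_lt; lra).
    assert (Rmin (m + del / 2) 1 <= m); [|lra].
    apply Hm1; split; [lra|].
    apply HP; [lra| |exact HPm].
    rewrite Rabs_pos_eq; lra.
  + now replace 1 with m by lra.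
Qed.

Lemma cont01_uniform n (A : R -> nat -> R) s eta :
  (forall i, (i <= n)%nat -> cont01 (fun s => A s i)) -> 0 <= s <= 1 -> 0 < eta ->
  exists del, 0 < del /\ forall s', 0 <= s' <= 1 -> Rabs (s' - s) < del ->
    forall i, (i <= n)%nat -> Rabs (A s' i - A s i) <= eta.
Proof.
intros HA Hs Heta; induction n as [|n IH].
- destruct (HA O (le_n _) s Hs eta Heta) as (del & Hdel & H).
  exists del; split; [exact Hdel|].
  intros s' Hs' Hss i Hi; replace i with O by lia; left; now apply H.
- destruct IH as (d1 & Hd1 & E1); [intros; apply HA; lia|].
  destruct (HA (S n) (le_n _) s Hs eta Heta) as (d2 & Hd2 & E2).
  exists (Rmin d1 d2); split; [now apply Rmin_pos|].
  pose proof (Rmin_l d1 d2); pose proof (Rmin_r d1 d2).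
  intros s' Hs' Hss i Hi.
  destruct (Nat.eq_dec i (S n)) as [->|Hne].
  + left; apply E2; [assumption|lra].
  + apply E1; [assumption|lra|lia].
Qed.

Lemma peval_minus n c c' t : peval n c' t = peval n c t + peval n (fun i => c' i - c i) t.
Proof.
unfold peval; rewrite <- sum_plus; apply sum_eq; intros; ring.
Qed.

Lemma peval_lipschitz n c eta C (D : R) t s :
  0 <= eta -> (forall i, (i <= n)%nat -> Rabs (c i) <= eta) ->
  (forall i, (i <= n)%nat -> Rabs (t ^ i - s ^ i) <= C * D) ->
  Rabs (peval n c t - peval n c s) <= eta * (C * D) * INR (S n).
Proof.
intros Heta Hc HC; unfold peval.
rewrite <- minus_sum, <- sum_cte.
apply sum_Rabs_le; intros i Hi.
rewrite <- Rmult_minus_distr_l, Rabs_mult.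
apply Rmult_le_compat; try apply Rabs_pos; auto.
Qed.

Lemma ambient_isotopic_ext F G F' G' :
  (forall p, F p = F' p) -> (forall p, G p = G' p) ->
  ambient_isotopic F G -> ambient_isotopic F' G'.
Proof.
intros HF HG (H & H1 & H2 & H3 & H4 & H5).
exists H; repeat split; try assumption; try (now apply H3).
intros p Hp; now rewrite <- HF, <- HG, H5.
Qed.

Lemma ext_knot_curve d a b c p : ext_knot d a b c p = ext_curve (pcurve d a b c) p.
Proof. now destruct p. Qed.

Lemma S3_ext_knot d a b c p : S3 (ext_knot d a b c p).
Proof.
rewrite ext_knot_curve; destruct p as [u v]; unfold ext_curve.
destruct (Req_EM_T v 1); [apply S3_N3|apply S3_inv_stereo].
Qed.

(** Both directions come from the estimate for the first knot alone, because a small displacement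
    keeps the two chord distances comparable; this takes the place of symmetry of ambient
    isotopy. *)
Lemma top_equivalent_nearby d a b c :
  (2 <= d)%nat -> in_Qd d a b c ->
  exists eta, 0 < eta /\ forall a' b' c',
    (forall i, (i <= d - 2)%nat -> Rabs (a' i - a i) <= eta) ->
    (forall i, (i <= d - 1)%nat -> Rabs (b' i - b i) <= eta) ->
    (forall i, (i <= d)%nat -> Rabs (c' i - c i) <= eta) ->
    top_equivalent d a b c a' b' c' /\ top_equivalent d a' b' c' a b c.
Proof.
intros Hd HQ.
destruct (pow_sub_le_dist1 d a b c Hd HQ) as (C & HC & Hpow).
assert (HN : 0 < INR (S d)) by (apply lt_0_INR; lia).
assert (HCN : 0 < 12 * (C + 1) * INR (S d)) by (apply Rmult_lt_0_compat; lra).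
(* Each component of the displacement becomes 1/12-Lipschitz, 1/4 in all. Chords of [phi] are then
   at most 4/3 of those of [psi], and 1/12 * 4/3 = 1/9 is below 1/6 for the way back. C + 1 keeps
   the denominator positive. *)
exists (/ (12 * (C + 1) * INR (S d))).
assert (Heta : 0 < / (12 * (C + 1) * INR (S d))) by now apply Rinv_0_lt_compat.
set (eta := / (12 * (C + 1) * INR (S d))) in *.
split; [exact Heta|].
intros a' b' c' Ha Hb Hc.
set (phi := pcurve d a b c); set (psi := pcurve d a' b' c').
set (v1 := peval (d - 2) (fun i => a' i - a i)).
set (v2 := peval (d - 1) (fun i => b' i - b i)).
set (v3 := peval d (fun i => c' i - c i)).
assert (Hsmall : forall n e, (n <= d)%nat -> (forall i, (i <= n)%nat -> Rabs (e i) <= eta) ->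
          forall t s, Rabs (peval n e t - peval n e s) <= / 12 * dist1 (phi t) (phi s)).
{ intros n e Hn He t s.
  apply Rle_trans with (eta * (C * dist1 (phi t) (phi s)) * INR (S n)).
  - apply peval_lipschitz; [lra|exact He|].
    intros i Hi; apply Hpow; lia.
  - assert (HnN : INR (S n) <= INR (S d)) by (apply le_INR; lia).
    pose proof (dist1_pos (phi t) (phi s)) as HD.
    assert (HCD : 0 <= eta * (C * dist1 (phi t) (phi s)))
      by (apply Rmult_le_pos; [lra|now apply Rmult_le_pos]).
    apply Rle_trans with (eta * ((C + 1) * dist1 (phi t) (phi s)) * INR (S d)).
    + apply Rmult_le_compat; [exact HCD|apply pos_INR| |exact HnN].
      apply Rmult_le_compat_l; [lra|].
      apply Rmult_le_compat_r; lra.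
    + right; unfold eta; field; lra. }
assert (H1 := Hsmall (d - 2)%nat _ ltac:(lia) Ha : forall t s, Rabs (v1 t - v1 s) <= _).
assert (H2 := Hsmall (d - 1)%nat _ ltac:(lia) Hb : forall t s, Rabs (v2 t - v2 s) <= _).
assert (H3 := Hsmall d _ ltac:(lia) Hc : forall t s, Rabs (v3 t - v3 s) <= _).
assert (Hpsi : forall t, psi t = padd (phi t) 1 (v1 t, v2 t, v3 t)).
{ intros t; unfold psi, phi, pcurve, padd, fA, gA, hA.
  rewrite (peval_minus _ a a'), (peval_minus _ b b'), (peval_minus _ c c').
  fold v1 v2 v3; now rewrite !Rmult_1_l. }
assert (Hphi : forall t, phi t = padd (psi t) 1 (- v1 t, - v2 t, - v3 t)).
{ intros t; rewrite Hpsi; unfold phi, pcurve, padd.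
  f_equal; [f_equal|]; ring. }
assert (Hback : forall t s, dist1 (phi t) (phi s) <= 4 / 3 * dist1 (psi t) (psi s)).
{ intros t s.
  pose proof (dist1_padd (psi t) (psi s) 1 1 (- v1 t, - v2 t, - v3 t)
    (- v1 s, - v2 s, - v3 s)) as E.
  rewrite <- !Hphi, Rminus_eq_0, Rabs_R0, Rabs_R1 in E.
  unfold dist1 at 3 in E.
  assert (Ho : forall x y, Rabs (- x - - y) = Rabs (x - y)).
  { intros x y; rewrite <- Rabs_Ropp; f_equal; ring. }
  rewrite !Ho in E.
  pose proof (H1 t s); pose proof (H2 t s); pose proof (H3 t s); lra. }
split; unfold top_equivalent.
- apply ambient_isotopic_ext with (ext_curve phi) (ext_curve psi);
    try (intros p; symmetry; apply ext_knot_curve).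
  apply ambient_isotopic_lipschitz_close with (1 := Hpsi).
  intros v [-> | [-> | ->]] t s; pose proof (dist1_pos (phi t) (phi s));
    pose proof (H1 t s); pose proof (H2 t s); pose proof (H3 t s); lra.
- apply ambient_isotopic_ext with (ext_curve psi) (ext_curve phi);
    try (intros p; symmetry; apply ext_knot_curve).
  apply ambient_isotopic_lipschitz_close with (1 := Hphi).
  assert (Ho : forall x y, Rabs (- x - - y) = Rabs (x - y)).
  { intros x y; rewrite <- Rabs_Ropp; f_equal; ring. }
  intros v [-> | [-> | ->]] t s; rewrite Ho; pose proof (dist1_pos (psi t) (psi s));
    pose proof (Hback t s);
    pose proof (H1 t s); pose proof (H2 t s); pose proof (H3 t s); lra.
Qed.

Theorem mainTheorem5 (d : nat) (hd : (2 <= d)%nat)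
  (a1 b1 c1 a2 b2 c2 : nat -> R) :
  same_path_component_Qd d a1 b1 c1 a2 b2 c2 ->
  top_equivalent d a1 b1 c1 a2 b2 c2.
Proof.
intros (A & B & C & HA & HB & HC & HQ & EA & EB & EC).
assert (Hpath : top_equivalent d (A 0) (B 0) (C 0) (A 1) (B 1) (C 1)).
{ apply (interval_induction
    (fun s => top_equivalent d (A 0) (B 0) (C 0) (A s) (B s) (C s))).
  (* Reflexivity, as the case of unchanged coefficients. *)
  - destruct (top_equivalent_nearby d _ _ _ hd (HQ 0 ltac:(lra))) as (eta & Heta & H).
    apply H; intros; rewrite Rminus_eq_0, Rabs_R0; lra.
  - intros s Hs.
    destruct (top_equivalent_nearby d _ _ _ hd (HQ s Hs)) as (eta & Heta & H).
    destruct (cont01_uniform _ A s eta HA Hs Heta) as (d1 & Hd1 & E1).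
    destruct (cont01_uniform _ B s eta HB Hs Heta) as (d2 & Hd2 & E2).
    destruct (cont01_uniform _ C s eta HC Hs Heta) as (d3 & Hd3 & E3).
    exists (Rmin d1 (Rmin d2 d3)); split; [repeat apply Rmin_pos; assumption|].
    pose proof (Rmin_l d1 (Rmin d2 d3)); pose proof (Rmin_r d1 (Rmin d2 d3)).
    pose proof (Rmin_l d2 d3); pose proof (Rmin_r d2 d3).
    intros s' Hs' Hss.
    destruct (H (A s') (B s') (C s')) as [T1 T2];
      [apply E1|apply E2|apply E3|]; try assumption; try lra.
    (* [T1] leads from [s] to [s'] and [T2] back, one for each implication. *)
    split; intros HP; eapply ambient_isotopic_trans; try exact HP; try assumption;
      intros; apply S3_ext_knot. }
(* The ends of the path agree with the given coefficients only in the relevant degrees, so the knots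
   are compared through their values. *)
assert (Ev : forall n e e' t, (forall i, (i <= n)%nat -> e i = e' i) ->
          peval n e t = peval n e' t).
{ intros n e e' t H; apply sum_eq; intros i Hi; now rewrite H. }
unfold top_equivalent; revert Hpath; apply ambient_isotopic_ext; intros [u v];
  unfold ext_knot; destruct (Req_EM_T v 1); try reflexivity; unfold fA, gA, hA;
  f_equal; apply Ev; intros i Hi; now (apply EA || apply EB || apply EC).
Qed.
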